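(* Let $n$ be a positive integer. Then the ring $C_{\mathrm{r}}(\overline{\mathbb{D}}^n;\mathbb{C})=\{f:\overline{\mathbb{D}}^n\to\mathbb{C} : f \text{ is continuous and } f(z)=\overline{f(\overline{z})} \text{ for all } z\in\overline{\mathbb{D}}^n\}$, with pointwise operations, is a projective free ring.
   Context: $\overline{\mathbb{D}}^n:=\{z=(z_1,\dots,z_n)\in\mathbb{C}^n : |z_j|\le 1,\ j=1,\dots,n\}$ is the closed polydisc. For $z=(z_1,\dots,z_n)\in\mathbb{C}^n$, $\overline{z}:=(\overline{z_1},\dots,\overline{z_n})$ denotes componentwise complex conjugation. A commutative ring $R$ with identity is called projective free if every finitely generated projective $R$-module is free. Here a finitely generated $R$-module $M$ is free if $M\simeq R^k$ for some integer $k\ge 0$, and projective if there exist an $R$-module $N$ and an integer $m\ge 0$ such that $M\oplus N\simeq R^m$. *)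

(* Defs.v *)
From HB Require Import structures.
From mathcomp Require Import all_boot all_order all_algebra.
From mathcomp Require Import complex.
From mathcomp Require Import all_classical all_reals all_analysis.

Set Implicit Arguments.
Unset Strict Implicit.
Unset Printing Implicit Defensive.

Import Order.TTheory GRing.Theory Num.Theory.
Import numFieldNormedType.Exports.

Local Open Scope classical_set_scope.
Local Open Scope ring_scope.

(* [pzRingType] is a ring with identity that may be trivial, so [comPzRingType]
   is the library's structure for an arbitrary commutative ring. *)
Section ProjectiveFree.
Variable A : comPzRingType.

Definition lmod_iso (M N : lmodType A) : Prop :=
  exists f : {linear M -> N}, bijective f.

Definition fin_generated (M : lmodType A) : Prop :=
  exists (k : nat) (g : 'I_k -> M),
    forall x : M, exists a : 'I_k -> A, x = \sum_(i < k) a i *: g i.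

Definition free_module (M : lmodType A) : Prop :=
  exists k : nat, lmod_iso M 'rV[A]_k.

Definition projective_module (M : lmodType A) : Prop :=
  exists (N : lmodType A) (m : nat), lmod_iso (M * N)%type 'rV[A]_m.

Definition projective_free : Prop :=
  forall M : lmodType A,
    fin_generated M -> projective_module M -> free_module M.

End ProjectiveFree.

(* The library puts the norm topology on abstract number fields only. *)
HB.instance Definition _ (R : realType) :=
  NormedModule.copy R[i] R[i]^o.

(* The norm of [R[i]] takes its values in the nonnegative reals of [R[i]], where
   the partial order of [R[i]] is the usual one. *)
Definition polydisc (R : realType) (n : nat) : set 'rV[R[i]]_n :=
  [set z | forall j, `|z ord0 j| <= 1].

Arguments polydisc R n : clear implicits.

Lemma conj_polydisc_subproof (R : realType) (n : nat) (z : polydisc R n) :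
  map_mx conjc (val z) \in polydisc R n.
Proof.
case: z => z /= /set_mem zD; apply/mem_set => j; rewrite mxE.
by move: (zD j); case: (z ord0 j) => a b; rewrite !normc_def /= sqrrN.
Qed.

Definition conj_polydisc (R : realType) (n : nat) (z : polydisc R n) :
  polydisc R n := exist (fun w => w \in polydisc R n) _ (conj_polydisc_subproof z).

Section Cr.
Variables (R : realType) (n : nat).

(* [polydisc R n], used as a type, carries the subtype topology. *)
Definition Cr_pred : {pred polydisc R n -> R[i]} :=
  fun f => `[< continuous f /\
               forall z, f z = conjc (f (conj_polydisc z)) >].

Lemma Cr_subring_closed : subring_closed Cr_pred.
Proof.
split.
- apply/asboolP; split; first exact: (@cst_continuous _ R[i] 1).
  by move=> z; rewrite [RHS](rmorph1 (@conjc R)).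
- move=> f g /asboolP[cf sf] /asboolP[cg sg]; apply/asboolP; split.
    by move=> z; exact: (cvgB (cf z) (cg z)).
  by move=> z; rewrite /= -[LHS]/(f z - g z) sf sg -(rmorphB (@conjc R)).
- move=> f g /asboolP[cf sf] /asboolP[cg sg]; apply/asboolP; split.
    by move=> z; exact: (cvgM (cf z) (cg z)).
  by move=> z; rewrite /= -[LHS]/(f z * g z) sf sg -(rmorphM (@conjc R)).
Qed.

HB.instance Definition _ := GRing.isSubringClosed.Build _ Cr_pred
  Cr_subring_closed.

Record Cr := MkCr {
  Cr_fun :> polydisc R n -> R[i];
  Cr_funP : Cr_fun \in Cr_pred }.

HB.instance Definition _ := [isSub for Cr_fun].
HB.instance Definition _ := [Choice of Cr by <:].
HB.instance Definition _ :=
  GRing.SubChoice_isSubComPzRing.Build _ _ Cr Cr_subring_closed.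

End Cr.

(* Main.v *)
From HB Require Import structures.
Require Import Defs.
From mathcomp Require Import all_boot all_order all_algebra.
From mathcomp Require Import complex lra.
From mathcomp Require Import all_classical all_reals all_analysis.

(* A finitely generated projective module is the image of an idempotent matrix
   P, so it suffices to split every P as B C with C B = 1. The polydisc is
   contracted to the origin by the real dilations z -> s z, which commute with
   conjugation; hence P deforms through the idempotents P_s(z) = P(s z) to the
   constant real matrix P_0, which splits by linear algebra over a field.
   Splitting is invariant under similarity, and two close idempotents P and Q
   are similar through U = P Q + (1 - P)(1 - Q): one has P U = U Q, and U is
   invertible as soon as det U vanishes nowhere on the polydisc. As det U = 1
   when P = Q, compactness of [0, 1] x polydisc provides a uniform step N^-1
   such that P_s and P_(s + N^-1) are similar for all s in [0, 1]. *)

Set Implicit Arguments.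
Unset Strict Implicit.
Unset Printing Implicit Defensive.

Import Order.TTheory GRing.Theory Num.Theory.
Import numFieldNormedType.Exports.

Local Open Scope classical_set_scope.
Local Open Scope ring_scope.

(** * Splitting of idempotent matrices and freeness of projective modules *)

Definition splits (A : pzRingType) m (P : 'M[A]_m) : Prop :=
  exists r (B : 'M[A]_(m, r)) (C : 'M[A]_(r, m)), P = B *m C /\ C *m B = 1%:M.

Lemma splits_map (A A' : pzRingType) (f : {rmorphism A -> A'}) m (P : 'M[A]_m) :
  splits P -> splits (map_mx f P).
Proof.
move=> [r [B [C [-> CB]]]]; exists r, (map_mx f B), (map_mx f C).
by rewrite map_mxM; split=> //; rewrite -map_mxM CB map_mx1.
Qed.

(** Rank factorization P = B C: the factor B is left cancellable and C right cancellable, so B (C B)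
    C = B C forces C B = 1. *)
Lemma splits_field (F : fieldType) m (P : 'M[F]_m) : P *m P = P -> splits P.
Proof.
move=> PP; exists (\rank P), (col_base P), (row_base P).
rewrite mulmx_base; split=> //.
(* Generalized, because [mulmxA] would unfold [col_base] and [row_base]. *)
move: (col_base P) (row_base P) (mulmx_base P) (col_base_full P)
  (row_base_free P) => B C PE fullB freeC.
apply: (row_free_inj freeC); apply: (row_full_inj fullB).
by rewrite /= mul1mx -!mulmxA PE mulmxA PE PP.
Qed.

Lemma splits_conj (A : pzRingType) m (P Q U V : 'M[A]_m) :
  V *m U = 1%:M -> P = U *m Q *m V -> splits Q -> splits P.
Proof.
move=> VU -> [r [B [C [-> CB]]]]; exists r, (U *m B), (C *m V).
by rewrite !mulmxA -(mulmxA C) VU mulmx1.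
Qed.

Section Intertwiner.
Variables (A : comPzRingType) (m : nat).
Implicit Types P Q : 'M[A]_m.

Definition intertwiner P Q := P *m Q + (1%:M - P) *m (1%:M - Q).

(** Both sides reduce to P Q, since P (1 - P) = 0 and (1 - Q) Q = 0. *)
Lemma intertwinerP P Q : P *m P = P -> Q *m Q = Q ->
  P *m intertwiner P Q = intertwiner P Q *m Q.
Proof.
move=> PP QQ; rewrite /intertwiner mulmxDr [RHS]mulmxDl !mulmxA PP.
rewrite -[P *m Q *m Q]mulmxA -[_ *m _ *m Q in RHS]mulmxA QQ.
rewrite [P *m (_ - _)]mulmxBr mulmx1 PP subrr mul0mx.
by rewrite [(_ - Q) *m Q]mulmxBl mul1mx QQ subrr mulmx0.
Qed.

Lemma intertwiner_id P : P *m P = P -> intertwiner P P = 1%:M.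
Proof.
move=> PP; rewrite /intertwiner PP mulmxBr mulmx1 mulmxBl mul1mx PP subrr subr0.
by rewrite addrC subrK.
Qed.

(** With d inverse to det U, the matrix d adj U is a two-sided inverse of U, so P U = U Q becomes P
    = U Q U^-1. *)
Lemma splits_intertwiner P Q (d : A) : P *m P = P -> Q *m Q = Q ->
  d * \det (intertwiner P Q) = 1 -> splits Q -> splits P.
Proof.
move=> PP QQ dU; set U := intertwiner P Q in dU *.
have VU : (d *: \adj U) *m U = 1%:M.
  by rewrite -scalemxAl mul_adj_mx scale_scalar_mx dU.
have UV : U *m (d *: \adj U) = 1%:M.
  by rewrite -scalemxAr mul_mx_adj scale_scalar_mx dU.
apply: splits_conj VU _.
by rewrite -intertwinerP// -mulmxA UV mulmx1.
Qed.

End Intertwiner.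

Lemma projective_freeP (A : comPzRingType) :
  (forall m (P : 'M[A]_m), P *m P = P -> splits P) -> projective_free A.
Proof.
move=> splitA M _ [N [m [f [g fK gK]]]].
(* The projection of M + N onto M, transported to row vectors; its matrix is the idempotent to
   split. *)
pose e v := f ((g v).1, 0).
have glin : linear g.
  by move=> a u v; apply: (can_inj fK); rewrite linearP !gK.
have elin : linear e.
  move=> a u v; rewrite /e -linearP glin; congr (f _); congr (_, _).
  by rewrite /= scaler0 addr0.
pose eL : {linear 'rV[A]_m -> 'rV[A]_m} :=
  HB.pack e (GRing.isLinear.Build _ _ _ _ e elin).
have eE v : v *m lin1_mx eL = f ((g v).1, 0) by rewrite mul_rV_lin1.
have PP : lin1_mx eL *m lin1_mx eL = lin1_mx eL.
  by apply/row_matrixP => i; rewrite !rowE mulmxA !eE fK.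
have [r [B [C [PE CB]]]] := splitA _ _ PP.
pose h (x : M) : 'rV[A]_r := f (x, 0) *m B.
have hlin : linear h.
  move=> a x y; rewrite /h scalemxAl -mulmxDl -linearP; congr (f _ *m _).
  by congr (_, _); rewrite /= scaler0 addr0.
pose hL : {linear M -> 'rV[A]_r} :=
  HB.pack h (GRing.isLinear.Build _ _ _ _ h hlin).
(* The two maps are mutually inverse because P = B C fixes every f (x, 0), and every w C, as C B =
   1. *)
exists r, hL, (fun w => (g (w *m C)).1) => [x|w] /=.
  by rewrite /h -mulmxA -PE eE !fK.
by rewrite /h -eE PE -!mulmxA CB mulmx1 CB mulmx1.
Qed.

(** * Compactness of the polydisc and continuity of matrix expressions *)

Lemma compact_set_type (X : topologicalType) (K : set X) :
  compact K -> compact [set: K].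
Proof.
move=> /compact_near_coveringP cK; apply/compact_near_coveringP.
move=> I F P FF cover.
(* Quantifying over membership proofs extends the predicate from the subtype to all of X, where
   compactness of K applies. *)
pose Q i y := forall Ky : y \in K, P i (exist _ y Ky).
apply: filterS (cK I F Q FF _).
  by move=> i Pi [y Ky] _; exact: (Pi y (set_mem Ky)).
move=> x Kx.
have [[/= U V] [Ux FV] sP] := cover (exist _ x (mem_set Kx)) Logic.I.
have [_ [[W oW <-] Wx sW]] := Ux.
exists (W, V) => /=; first by split=> //; exact: open_nbhs_nbhs.
move=> [y i] [/= Wy Vi] Ky; apply: (sP (exist _ y Ky, i)); split=> //.
exact: sW.
Qed.

Lemma continuous_det (T : topologicalType) (K : numFieldType) m
    (A : T -> 'M[K]_m) :
  (forall i j, continuous (fun x => A x i j)) ->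
  continuous (fun x => \det (A x)).
Proof.
move=> cA; rewrite /determinant.
apply: (continuous_big (@add_continuous K^o)) => s _ x.
apply: cvgM; first exact: cvg_cst.
by apply: (continuous_big (@mul_continuous K)) => i _; exact: cA.
Qed.

Lemma continuous_mulmx (T : topologicalType) (K : numFieldType) m n p
    (A : T -> 'M[K]_(m, n)) (B : T -> 'M[K]_(n, p)) :
  (forall i j, continuous (fun x => A x i j)) ->
  (forall i j, continuous (fun x => B x i j)) ->
  forall i j, continuous (fun x => (A x *m B x) i j).
Proof.
move=> cA cB i j.
under eq_fun do rewrite mxE.
apply: (continuous_big (@add_continuous K^o)) => k _ x.
by apply: cvgM; [exact: cA | exact: cB].
Qed.

Lemma continuous_intertwiner (T : topologicalType) (K : numFieldType) m
    (A B : T -> 'M[K]_m) :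
  (forall i j, continuous (fun x => A x i j)) ->
  (forall i j, continuous (fun x => B x i j)) ->
  forall i j, continuous (fun x => intertwiner (A x) (B x) i j).
Proof.
move=> cA cB i j; rewrite /intertwiner.
have c1B (C : T -> 'M[K]_m) : (forall i j, continuous (fun x => C x i j)) ->
    forall i j, continuous (fun x => (1%:M - C x) i j).
  move=> cC k l; under eq_fun do rewrite mxE [X in _ + X]mxE.
  by move=> x; apply: cvgB; [exact: cvg_cst | exact: cC].
under eq_fun do rewrite mxE.
move=> x; exact: (cvgD (continuous_mulmx cA cB (x := x))
  (continuous_mulmx (c1B _ cA) (c1B _ cB) (x := x))).
Qed.

Section Disc.
Variable R : realType.

Lemma real_complex_continuous : continuous (fun x : R => x%:C%C : R[i]).
Proof.
(* The radius e is a positive element of [R[i]], so its imaginary part vanishes and the estimate can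
   be made in R. *)
move=> x; apply/cvgrPdist_lt => e; rewrite ltcE /= => /andP[/eqP e0 ?].
near=> y.
have -> : x%:C%C - y%:C%C = (x - y)%:C%C :> R[i] by rewrite rmorphB.
rewrite normc_def /= expr0n addr0 sqrtr_sqr ltcE /= e0 eqxx /=.
by near: y; exact: cvgr_dist_lt.
Unshelve. all: by end_near. Qed.

(** The disc is the continuous image, under (a, b) -> a + i b, of the closed subset a^2 + b^2 <= 1
    of the compact square [-1, 1]^2. *)
Lemma compact_disc : compact [set z : R[i] | `|z| <= 1].
Proof.
pose c (p : R * R) : R[i] := p.1%:C%C + 'i%C * p.2%:C%C.
have cc : continuous c.
  move=> p; apply: cvgD.
    apply: (@continuous_comp _ _ _ fst) => //; first exact: cvg_fst.
    exact: real_complex_continuous.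
  apply: cvgM; first exact: cvg_cst.
  apply: (@continuous_comp _ _ _ snd) => //; first exact: cvg_snd.
  exact: real_complex_continuous.
pose q (p : R * R) : R := p.1 * p.1 + p.2 * p.2.
have cq : continuous q.
  by move=> p; apply: cvgD; apply: cvgM; (exact: cvg_fst || exact: cvg_snd).
have -> : [set z : R[i] | `|z| <= 1] =
    c @` ((`[-1, 1] `*` `[-1, 1]) `&` q @^-1` [set x | x <= 1]).
  apply/seteqP; split=> [[a b]|_ [[a b] [_ /= qab] <-]].
    rewrite /= normc_def lecE /= => /andP[_ ab].
    have {}ab : a * a + b * b <= 1.
      have := sqr_sqrtr (addr_ge0 (sqr_ge0 a) (sqr_ge0 b)).
      rewrite -!expr2 => <-.
      by rewrite exprn_ile1 ?sqrtr_ge0.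
    exists (a, b); last by rewrite /c /= [RHS]complexE.
    by split=> //; split; rewrite /= in_itv /=; apply/andP; split; nra.
  rewrite /c -[_ + _](complexE (a +i* b)%C) normc_def lecE /= eqxx /=.
  by rewrite -sqrtr1 ler_wsqrtr.
apply: continuous_compact; first exact: continuous_subspaceT.
apply: compact_closedI.
  by apply: compact_setX; exact: segment_compact.
by apply: closed_comp => //; exact: closed_le.
Qed.

End Disc.

Lemma compact_polydisc (R : realType) n : compact (polydisc R n).
Proof. by apply: (rV_compact (fun=> @compact_disc R)). Qed.

(** * Real dilations of the polydisc *)

Section Dilation.
Variables (R : realType) (n : nat).

(* Truncation makes [dilate] total and continuous in its real parameter. *)
Definition clamp (s : R) : R := Num.min 1 `|s|.

Lemma clamp_continuous : continuous clamp.
Proof.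
by move=> s; apply: continuous_min; [exact: cvg_cst | exact: norm_continuous].
Qed.

Lemma clampE s : 0 <= s <= 1 -> clamp s = s.
Proof. by move=> /andP[s0 s1]; rewrite /clamp ger0_norm// min_r. Qed.

Lemma dilate_subproof (s : R) (z : polydisc R n) :
  (clamp s)%:C%C *: val z \in polydisc R n.
Proof.
case: z => z /= /set_mem zD; apply/mem_set => j; rewrite mxE normrM.
have /andP[s0 s1] : 0 <= clamp s <= 1.
  by rewrite /clamp ge_min lexx le_min ler01 normr_ge0.
by rewrite mulr_ile1 //= ger0_norm ?ler0c // (@lecR _ _ 1).
Qed.

Definition dilate (s : R) (z : polydisc R n) : polydisc R n :=
  exist (fun w => w \in polydisc R n) _ (dilate_subproof s z).

Lemma continuous_dilate (T : topologicalType) (f : T -> R)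
    (g : T -> polydisc R n) :
  continuous f -> continuous g -> continuous (fun x => dilate (f x) (g x)).
Proof.
(* The subtype topology is initial for [val], so only continuity of the underlying scalar multiple
   is at stake. *)
move=> cf cg; apply: continuous_comp_initial => x.
apply: (@cvgZ _ 'rV[R[i]]_n).
  apply: (@continuous_comp _ _ _ (clamp \o f)).
    by apply: continuous_comp; [exact: cf | exact: clamp_continuous].
  exact: real_complex_continuous.
by apply: (@continuous_comp _ _ _ g); [exact: cg | exact: initial_continuous].
Qed.

Lemma dilate_conj s z : dilate s (conj_polydisc z) = conj_polydisc (dilate s z).
Proof.
apply/val_inj/rowP => j; rewrite !mxE rmorphM /=.
by congr (_ * _); rewrite oppr0.
Qed.

Lemma dilate1 z : dilate 1 z = z.
Proof. by apply/val_inj; rewrite /= clampE ?ler01 ?lexx// scale1r. Qed.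

Lemma dilate0 z w : dilate 0 z = dilate 0 w.
Proof. by apply/val_inj; rewrite /= clampE ?ler01 ?lexx// !scale0r. Qed.

End Dilation.

(** * Evaluations, real constants, dilations and units of the function ring *)

Section CrMorphisms.
Variables (R : realType) (n : nat).
Local Notation Cr := (Cr R n).
Implicit Types (f g : Cr) (z : polydisc R n).

Lemma Cr_ext f g : f =1 g -> f = g.
Proof. by move=> fg; apply/val_inj/funext. Qed.

Lemma Cr_continuous f : continuous f.
Proof. by have /asboolP[] := Cr_funP f. Qed.

Lemma Cr_conj f z : f (conj_polydisc z) = conjc (f z).
Proof. by have /asboolP[_ fz] := Cr_funP f; rewrite [in RHS]fz conjcK. Qed.

Definition Cr_eval z f : R[i] := f z.

Lemma Cr_eval_is_zmod_morphism z : zmod_morphism (Cr_eval z).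
Proof. by []. Qed.

Lemma Cr_eval_is_monoid_morphism z : monoid_morphism (Cr_eval z).
Proof. by []. Qed.

HB.instance Definition _ z := GRing.isZmodMorphism.Build Cr R[i] (Cr_eval z)
  (Cr_eval_is_zmod_morphism z).
HB.instance Definition _ z := GRing.isMonoidMorphism.Build Cr R[i] (Cr_eval z)
  (Cr_eval_is_monoid_morphism z).

Lemma Cr_const_subproof (x : R) : (fun=> x%:C%C) \in @Cr_pred R n.
Proof.
apply/asboolP; split; first exact: (@cst_continuous _ R[i]).
by move=> z; rewrite /= oppr0.
Qed.

Definition Cr_const (x : R) : Cr := MkCr (Cr_const_subproof x).

Lemma Cr_const_is_zmod_morphism : zmod_morphism Cr_const.
Proof. by move=> x y; apply: Cr_ext => z; rewrite /= rmorphB. Qed.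

Lemma Cr_const_is_monoid_morphism : monoid_morphism Cr_const.
Proof. by split=> [|x y]; apply: Cr_ext => z; rewrite /= ?rmorphM. Qed.

HB.instance Definition _ := GRing.isZmodMorphism.Build R Cr Cr_const
  Cr_const_is_zmod_morphism.
HB.instance Definition _ := GRing.isMonoidMorphism.Build R Cr Cr_const
  Cr_const_is_monoid_morphism.

Lemma Cr_dilate_subproof (s : R) f : (f \o dilate s) \in @Cr_pred R n.
Proof.
apply/asboolP; split=> [z|z]; last by rewrite /= dilate_conj Cr_conj conjcK.
apply: continuous_comp; last exact: Cr_continuous.
by apply: continuous_dilate => [|{}z]; [exact: cst_continuous | exact: cvg_id].
Qed.

Definition Cr_dilate (s : R) f : Cr := MkCr (Cr_dilate_subproof s f).

Lemma Cr_dilate_is_zmod_morphism s : zmod_morphism (Cr_dilate s).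
Proof. by move=> f g; exact: Cr_ext. Qed.

Lemma Cr_dilate_is_monoid_morphism s : monoid_morphism (Cr_dilate s).
Proof. by split=> [|f g]; exact: Cr_ext. Qed.

HB.instance Definition _ s := GRing.isZmodMorphism.Build Cr Cr (Cr_dilate s)
  (Cr_dilate_is_zmod_morphism s).
HB.instance Definition _ s := GRing.isMonoidMorphism.Build Cr Cr (Cr_dilate s)
  (Cr_dilate_is_monoid_morphism s).

Lemma Cr_dilate1 f : Cr_dilate 1 f = f.
Proof. by apply: Cr_ext => z; rewrite /= dilate1. Qed.

Lemma polydisc0_subproof : 0 \in polydisc R n.
Proof. by apply/mem_set => j; rewrite mxE normr0 ler01. Qed.

Definition polydisc0 : polydisc R n :=
  exist (fun w => w \in polydisc R n) _ polydisc0_subproof.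

Lemma Cr_const_inj : injective Cr_const.
Proof. by move=> x y /(congr1 (Cr_eval polydisc0)) []. Qed.

Lemma Cr_dilate0 f : exists x, Cr_dilate 0 f = Cr_const x.
Proof.
pose z0 := polydisc0.
exists (complex.Re (Cr_dilate 0 f z0)); apply: Cr_ext => z /=.
rewrite (dilate0 z z0); have := Cr_conj (Cr_dilate 0 f) z0.
rewrite /= (dilate0 (conj_polydisc z0) z0).
(* The value at the origin equals its own conjugate, so its imaginary part b satisfies b = - b. *)
by case: (f _) => a b /= [] bN; congr (_ +i* _)%C; lra.
Qed.

(** The pointwise inverse is again continuous and compatible with conjugation. *)
Lemma Cr_inv f : (forall z, f z != 0) -> exists g, g * f = 1.
Proof.
move=> f0; have gP : (fun z => (f z)^-1) \in @Cr_pred R n.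
  apply/asboolP; split=> [z|z]; first exact: (cvgV (f0 z) (@Cr_continuous f z)).
  by rewrite /= Cr_conj (fmorphV (@conjc R)) /= conjcK.
by exists (MkCr gP); apply: Cr_ext => z; exact: mulVf.
Qed.

End CrMorphisms.

(** * Deformation of an idempotent to a constant one *)

Section Homotopy.
Variables (R : realType) (n m : nat) (P : 'M[Cr R n]_m).
Hypothesis PP : P *m P = P.

Let D s := map_mx (@Cr_dilate R n s) P.

Let DD s : D s *m D s = D s.
Proof. by rewrite -map_mxM PP. Qed.

(** The determinant is jointly continuous in (s, z, d) and equals 1 at d = 0; compactness makes the
    neighbourhood of 0 uniform in s and z. Where s + d leaves [0, 1], [clamp] keeps the dilation
    inside the polydisc. *)
Lemma det_intertwiner_near0 : \forall d \near (0 : R),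
  forall s z, 0 <= s <= 1 ->
    Cr_eval z (\det (intertwiner (D (s + d)) (D s))) != 0.
Proof.
pose E z := map_mx (Cr_eval z) P.
(* Evaluation at z is a ring morphism, so it commutes with determinants and reduces the claim to
   complex matrices. *)
have detE z s t : Cr_eval z (\det (intertwiner (D s) (D t))) =
    \det (intertwiner (E (dilate s z)) (E (dilate t z))).
  rewrite -det_map_mx /intertwiner map_mxD !map_mxM !map_mxB map_mx1.
  by rewrite -!map_mx_comp.
have /compact_near_coveringP cov :
    compact (`[0 : R, 1]%classic `*` [set: polydisc R n]).
  apply: compact_setX; first exact: segment_compact.
  by apply: compact_set_type; exact: compact_polydisc.
pose h (q : (R * polydisc R n) * R) :=
  \det (intertwiner (E (dilate (q.1.1 + q.2) q.1.2)) (E (dilate q.1.1 q.1.2))).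
have c11 : continuous (fun q : (R * polydisc R n) * R => q.1.1).
  by move=> x; apply: (@continuous_comp _ _ _ fst fst); exact: cvg_fst.
have c12 : continuous (fun q : (R * polydisc R n) * R => q.1.2).
  move=> x; apply: (@continuous_comp _ _ _ fst snd); first exact: cvg_fst.
  exact: cvg_snd.
have contE (a : (R * polydisc R n) * R -> R) b : continuous a -> continuous b ->
    forall i j, continuous (fun q => E (dilate (a q) (b q)) i j).
  move=> ca cb i j; rewrite /E; under eq_fun do rewrite mxE.
  pose w q := dilate (a q) (b q).
  move=> q; apply: (@continuous_comp _ _ _ w (P i j)); last exact: Cr_continuous.
  exact: continuous_dilate.
have ch : continuous h.
  apply: continuous_det; apply: continuous_intertwiner.
    apply: contE; last exact: c12.
    by move=> x; apply: cvgD; [exact: c11 | exact: cvg_snd].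
  by apply: contE; [exact: c11 | exact: c12].
have h1 s z : h ((s, z), 0) = 1.
  rewrite /h /= addr0 intertwiner_id ?det1//.
  by rewrite -map_mxM PP.
apply: filterS (cov R (nbhs (0 : R)) (fun d p => h (p, d) != 0) _ _) => /=.
  move=> d hd s z s01; rewrite detE.
  by apply: (hd (s, z)); split=> //=; rewrite in_itv.
move=> [s z] _; have := ch ((s, z), 0); rewrite /continuous_at h1 => h_cvg.
have := cvgr_neq0 (FF := nbhs_filter _) _ h_cvg (oner_neq0 _).
by apply: filterS => -[].
Qed.

Lemma splits_dilate0 : splits (D 0).
Proof.
have /choice[c cE] := fun ij => Cr_dilate0 (P ij.1 ij.2).
have D0E : D 0 = map_mx (@Cr_const R n) (\matrix_(i, j) c (i, j)).
  by apply/matrixP => i j; rewrite !mxE (cE (i, j)).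
rewrite D0E; apply/splits_map/splits_field/matrixP => i j.
(* Idempotency over the field R is read off from that of [D 0], the embedding of constants being
   injective. *)
apply: (@Cr_const_inj R n); have := DD 0.
by rewrite D0E -map_mxM => /matrixP/(_ i j); rewrite [LHS]mxE [RHS]mxE.
Qed.

Lemma splits_idempotent : splits P.
Proof.
have [N dN] : exists N : nat, forall s z, 0 <= s <= 1 ->
    Cr_eval z (\det (intertwiner (D (s + N.+1%:R^-1)) (D s))) != 0.
  have /nbhs_ballP[e /= e0 dP] := det_intertwiner_near0.
  have [N _ Ne] := near_infty_natSinv_lt (PosNum e0).
  exists N => s z; apply: dP; rewrite /ball /= sub0r normrN.
  by rewrite ger0_norm ?invr_ge0 ?ler0n//; exact: (Ne N (leqnn N)).
(* Splitting propagates from [D 0] to [D 1], which is P, in N + 1 equal steps; each step starts at a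
   point k / (N + 1) of [0, 1]. *)
have split_k k : (k <= N.+1)%N -> splits (D (k%:R / N.+1%:R)).
  elim: k => [_|k IHk kN].
    by rewrite mul0r; exact: splits_dilate0.
  have -> : k.+1%:R / N.+1%:R = k%:R / N.+1%:R + N.+1%:R^-1 :> R.
    by rewrite -natr1 mulrDl div1r.
  have s01 : 0 <= (k%:R / N.+1%:R : R) <= 1.
    by rewrite divr_ge0 ?ler0n//= ler_pdivrMr ?ltr0n// mul1r ler_nat ltnW.
  have [d dE] := Cr_inv (dN _ ^~ s01).
  by apply: (splits_intertwiner (DD _) (DD _) dE); exact: IHk (ltnW kN).
have := split_k N.+1 (leqnn _); rewrite divff ?pnatr_eq0//.
by congr splits; apply/matrixP => i j; rewrite mxE Cr_dilate1.
Qed.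

End Homotopy.

Theorem theorem1p2 (R : realType) (n : nat) (hn : (0 < n)%N) :
  projective_free (Cr R n).
Proof. exact: (projective_freeP (@splits_idempotent R n)). Qed.
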